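(* Let $k\ge 4$ and let $H\subseteq\binom{[n]}{k}$ be a nonempty shifted $k$-uniform hypergraph. Suppose that either $s_H$ is undefined (the degenerate cases described in the context), or $s_H$ is defined and $s_H\notin H$. Then $H$ is matroidal if and only if the hyperedges of $H$ form an initial lex-segment.
   Context: Fix an arbitrary field $\mathbb F$ and a field extension $\mathbb L\supseteq\mathbb F$ of transcendence degree at least $n^2$; let $X=(x_{ij})_{1\le i,j\le n}$ be an $n\times n$ matrix over $\mathbb L$ whose entries are algebraically independent over $\mathbb F$. For $S,T\in\binom{[n]}{k}$ let $X_{ST}$ be the $k\times k$ minor of $X$ with rows $S$ and columns $T$. Equal-size subsets of $[n]$ are ordered lexicographically: $S<_{\text{lex}}T$ iff $\min(S\triangle T)\in S$. For $G\subseteq\binom{[n]}{k}$, the exterior shifting $\Delta^e(G)$ is the set of those $T\in\binom{[n]}{k}$ such that the column indexed by $T$ of the matrix $(X_{ST})_{S\in G,\,T\in\binom{[n]}{k}}$ is not in the span of the columns indexed by $T'<_{\text{lex}}T$. $H\subseteq\binom{[n]}k$ is shifted if whenever $i<j$, $j\in S\in H$, $i\notin S$, also $(S\setminus\{j\})\cup\{i\}\in H$. For shifted $H$, $M(H)=\{G\subseteq\binom{[n]}{k}:\Delta^e(G)=H\}$, and $H$ is matroidal if $M(H)$ is the set of bases of a matroid on $\binom{[n]}{k}$. The hyperedges of $H$ form an initial lex-segment if $H=\{T'\in\binom{[n]}{k}:T'\le_{\text{lex}}T\}$ for some $T$. Definition of $s_H$. Let $m_H$ be the lexicographically largest element of $H$.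 Case 1: $\max m_H=d<n$. Let $c+l$ be the second largest element of $m_H$ and let $c\le c+l$ be minimal with $\{c,c+1,\dots,c+l\}\subseteq m_H$ (so $c-1\notin m_H$), and let $A=m_H\setminus\{c,\dots,c+l,d\}$ (all elements of $A$ are $<c-1$; $A$ may be empty). If $c=1$, $s_H$ is undefined (then $H$ is an initial lex-segment). Otherwise $s_H=A\cup\{c-1\}\cup\{n-(l+1),n-l,\dots,n-1\}$. Case 2: $\max m_H=n$. Let $m\ge0$ be maximal with $\{n-m,\dots,n\}\subseteq m_H$. If $m_H=\{n-m,\dots,n\}$, $s_H$ is undefined (then $H$ is complete). Otherwise let $c+l=\max(m_H\setminus\{n-m,\dots,n\})$ (so $c+l<n-m-1$), let $c\le c+l$ be minimal with $\{c,\dots,c+l\}\subseteq m_H$, and $A=m_H\setminus(\{c,\dots,c+l\}\cup\{n-m,\dots,n\})$ (elements $<c-1$). If $c=1$, $s_H$ is undefined (then $H$ is an initial lex-segment). Otherwise $s_H=A\cup\{c-1\}\cup\{n-m-l,\dots,n-m-1\}\cup\{n-m,\dots,n\}$. In all defined cases $s_H$ is a $k$-subset of $[n]$. *)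

(* Defs.v *)
From mathcomp Require Import all_boot all_order all_algebra.
From mathcomp Require Import mpoly.

Set Implicit Arguments.
Unset Strict Implicit.
Unset Printing Implicit Defensive.

Import GRing.Theory.

(* The paper's [n] = {1, ..., n} is 'I_n, the ordinal i standing for i + 1. *)
Definition ksub (n k : nat) := {S : {set 'I_n} | #|S| == k}.

Definition symdiff n (S T : {set 'I_n}) : {set 'I_n} := (S :\: T) :|: (T :\: S).

(* The minimum of the symmetric difference exists and belongs to S. *)
Definition ltlex n (S T : {set 'I_n}) : bool :=
  [exists i in symdiff S T, [forall j in symdiff S T, i <= j] && (i \in S)].

Definition lelex n (S T : {set 'I_n}) : bool := (S == T) || ltlex S T.

Definition edges n k (H : {set ksub n k}) : {set {set 'I_n}} :=
  [set val S | S in H].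

Definition shifted n k (H : {set ksub n k}) : Prop :=
  forall (i j : 'I_n) (S : {set 'I_n}), i < j ->
    j \in S -> S \in edges H -> i \notin S -> i |: (S :\ j) \in edges H.

Definition initial_lex_segment n k (H : {set ksub n k}) : Prop :=
  exists T : ksub n k, H = [set T' : ksub n k | lelex (val T') (val T)].

Definition alg_independent (F L : fieldType) (iota : {rmorphism F -> L})
    m (x : 'I_m -> L) : Prop :=
  forall p : {mpoly F[m]}, mmap iota x p = 0%R -> p = 0%R.

Definition generic_matrix (F L : fieldType) (iota : {rmorphism F -> L})
    n (X : 'M[L]_n) : Prop :=
  alg_independent iota (fun r : 'I_(n * n) => mxvec X ord0 r).

Section Shifting.
Variables (L : fieldType) (n k : nat) (X : 'M[L]_n).

(* The elements of S listed in increasing order (enum is increasing on 'I_n). *)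
Definition ksub_nth (S : ksub n k) (a : 'I_k) : 'I_n :=
  enum_val (cast_ord (esym (eqP (valP S))) a).

Definition minor (S T : ksub n k) : L :=
  (\det (mxsub (ksub_nth S) (ksub_nth T) X))%R.

(* Column T of the matrix (X_ST), rows S in G. *)
Definition compound_col (G : {set ksub n k}) (T : ksub n k) : 'cV[L]_#|G| :=
  (\col_(a < #|G|) minor (enum_val a) T)%R.

Definition exterior_shift (G : {set ksub n k}) : {set ksub n k} :=
  [set T | compound_col G T \notin
     <<[seq compound_col G T'
         | T' in [set T' : ksub n k | ltlex (val T') (val T)]]>>%VS].

Definition shift_fiber (H : {set ksub n k}) : {set {set ksub n k}} :=
  [set G | exterior_shift G == H].

End Shifting.

Definition matroid_bases (E : finType) (B : {set {set E}}) : Prop :=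
  B != set0 /\
  forall B1 B2, B1 \in B -> B2 \in B -> forall x, x \in B1 :\: B2 ->
    exists2 y, y \in B2 :\: B1 & y |: (B1 :\ x) \in B.

Definition matroidal (L : fieldType) n k (X : 'M[L]_n) (H : {set ksub n k}) :=
  matroid_bases (shift_fiber X H).

(* From here to [labels], elements of [n] are the numbers 1, ..., n, and a
   subset of [n] is a list of them. *)
Definition maxl (s : seq nat) : nat := \max_(x <- s) x.

Definition removel (s t : seq nat) : seq nat := [seq x <- s | x \notin t].

Definition interval (a b : nat) : seq nat := index_iota a b.+1.

(* The least c with {c, ..., b} included in s, for b in s and 0 not in s.
   As b is in s, some c <= b qualifies, so intervals with c > b (which are
   empty) are never reached. *)
Definition run_start (s : seq nat) (b : nat) : nat :=
  find (fun c => all (mem s) (interval c b)) (iota 0 b.+1).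

Definition s_labels1 (n : nat) (mH : seq nat) : option (seq nat) :=
  let d := maxl mH in
  let b := maxl (removel mH [:: d]) in
  let c := run_start mH b in
  let l := b - c in
  let A := removel mH (d :: interval c b) in
  if c == 1 then None
  else Some (A ++ c.-1 :: interval (n - l.+1) n.-1).

Definition s_labels2 (n : nat) (mH : seq nat) : option (seq nat) :=
  let m := \max_(j < n | all (mem mH) (interval (n - j) n)) (j : nat) in
  let top := interval (n - m) n in
  let rest := removel mH top in
  if rest is [::] then None else
  let b := maxl rest in
  let c := run_start mH b in
  let l := b - c in
  let A := removel mH (interval c b ++ top) in
  if c == 1 then None
  else Some (A ++ c.-1 :: interval (n - m - l) (n - m - 1) ++ top).

Definition s_labels (n : nat) (mH : seq nat) : option (seq nat) :=
  if maxl mH < n then s_labels1 n mH else s_labels2 n mH.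

Definition labels n (S : {set 'I_n}) : seq nat :=
  [seq (i : 'I_n).+1 | i <- enum S].

Definition of_labels n (s : seq nat) : {set 'I_n} := [set i : 'I_n | i.+1 \in s].

Definition lex_max n k (H : {set ksub n k}) : option {set 'I_n} :=
  [pick S in edges H | [forall T in edges H, lelex T S]].

(* None means that s_H is undefined; when H is nonempty, lex_max H is never
   None. *)
Definition s_of n k (H : {set ksub n k}) : option {set 'I_n} :=
  obind (fun mH => omap (of_labels n) (s_labels n (labels mH))) (lex_max H).

(* Main.v *)
(* For a hypergraph G and an initial lex-segment D, let r_D(G) be the rank of
   the compound matrix restricted to rows G and columns D. Then Delta(G) = H
   iff r_D(G) = |H :&: D| for every D, so for an initial lex-segment H the
   fiber is the set of bases of the row matroid of the columns H.

   Conversely, let H not be an initial lex-segment, m its lex-largest element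
   and a the initial lex-segment ending at the last set below m outside H;
   everything lexicographically between a and m is then in H. Let G be in the
   fiber. Its r_a-closure is not everything as |H :&: a| < |a|, and G has an
   element x0 that is not an r_a-coloop as r_a(G) < |G|. By genericity all
   ranks are invariant under permutations of the vertices, so some pG has an
   r_a-closure P missing x0. A basis B of P for the columns up to m that
   contains G :&: P is again in the fiber. As x0 \notin P, the nullity of
   G :&: P for r_a is smaller than that of G, hence than that of B, so some
   x in B :\: G is not an r_a-coloop of B. If the fiber were the bases of a
   matroid, x could be exchanged for some y in G :\: B; keeping r_a forces y
   into P, hence into G :&: P, which is contained in B: a contradiction. *)
Require Import Defs.
From mathcomp Require Import all_boot all_order all_algebra all_fingroup.
From mathcomp Require Import mpoly zify.

Set Implicit Arguments.
Unset Strict Implicit.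
Unset Printing Implicit Defensive.

Import GRing.Theory.

(** Serves for the rank both as a function of the rows and as a function of the columns. *)
Lemma subadd_card (E : finType) (f : {set E} -> nat) (A B : {set E}) :
    (forall e S, f (e |: S) <= (f S).+1) -> A \subset B ->
  f B <= f A + #|B :\: A|.
Proof.
move=> fU sAB; have [m] := ubnP #|B :\: A|.
elim: m B sAB => // m IHm B sAB; rewrite ltnS => leBm.
have [/eqP|[e]] := set_0Vmem (B :\: A).
  rewrite setD_eq0 => sBA; have -> : B = A by apply/eqP; rewrite eqEsubset sBA.
  exact: leq_addr.
rewrite inE => /andP[eA eB].
have sAB' : A \subset B :\ e by rewrite subsetD1 sAB.
have cardB : #|B :\: A| = #|(B :\ e) :\: A|.+1.
  rewrite (cardsD1 e (B :\: A)) inE eA eB add1n; congr (#|pred_of_set _|.+1).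
  by apply/setP => x; rewrite !inE; case: (x == e); rewrite ?andbF.
have /IHm := sAB'; rewrite -ltnS -cardB ltnS => /(_ leBm) leB.
rewrite -{1}(setD1K eB) cardB addnS.
exact: leq_trans (fU _ _) _.
Qed.

(** * Ranks of sets of rows restricted to sets of columns *)

Section RowRank.

Local Open Scope ring_scope.

Variables (L : fieldType) (E : finType) (C : E -> E -> L).
Implicit Types (A B D : {set E}) (e t : E).

(** Columns outside [D] are zeroed rather than deleted, so the rows for all [D] live in one space
    and share their dimensions. *)
Definition rvec D e : 'rV[L]_#|E| :=
  \row_j (C e (enum_val j) *+ (enum_val j \in D)).

Definition rspan D A : 'M[L]_#|E| := (\sum_(e in A) <<rvec D e>>)%MS.

Definition rk D A : nat := \rank (rspan D A).

Lemma rspan_subP D A m (M : 'M_(m, #|E|)) :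
  reflect (forall e, e \in A -> (rvec D e <= M)%MS) (rspan D A <= M)%MS.
Proof.
apply: (iffP sumsmx_subP) => sM e /sM; by rewrite genmxE.
Qed.

Lemma rvec_sub D A e : e \in A -> (rvec D e <= rspan D A)%MS.
Proof. by move=> eA; apply: (sumsmx_sup e) => //; rewrite genmxE. Qed.

Lemma rspanS D A B : A \subset B -> (rspan D A <= rspan D B)%MS.
Proof. by move/subsetP=> sAB; apply/rspan_subP => e /sAB /rvec_sub. Qed.

Lemma rkS D A B : A \subset B -> (rk D A <= rk D B)%N.
Proof. by move=> sAB; apply/mxrankS/rspanS. Qed.

Lemma rk0 D : rk D set0 = 0%N.
Proof. by rewrite /rk /rspan big_set0 mxrank0. Qed.

Lemma rspanU1 D A e : (rspan D (e |: A) :=: rspan D A + rvec D e)%MS.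
Proof.
apply/eqmxP/andP; split.
  apply/rspan_subP => f; rewrite in_setU1 => /predU1P[->|fA].
    exact: addsmxSr.
  exact: submx_trans (rvec_sub D fA) (addsmxSl _ _).
by rewrite addsmx_sub rspanS ?subsetUr // rvec_sub ?setU11.
Qed.

Lemma rkU1 D A e : (rk D (e |: A) <= (rk D A).+1)%N.
Proof.
rewrite /rk rspanU1 -[leqRHS]addn1; apply: leq_trans (mxrank_adds_leqif _ _) _.
by rewrite leq_add2l rank_leq_row.
Qed.

Lemma rk_spanP D A e : reflect (rk D (e |: A) = rk D A) (rvec D e <= rspan D A)%MS.
Proof.
have sA : (rspan D A <= rspan D (e |: A))%MS by rewrite rspanS ?subsetUr.
have -> : (rvec D e <= rspan D A)%MS = (rspan D (e |: A) <= rspan D A)%MS.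
  by rewrite rspanU1 addsmx_sub submx_refl.
rewrite -(mxrank_leqif_sup sA) eq_sym; exact: eqP.
Qed.

Lemma rkU1_notin D A e : ~~ (rvec D e <= rspan D A)%MS ->
  rk D (e |: A) = (rk D A).+1.
Proof.
move/rk_spanP/eqP => ne; apply/eqP; rewrite eqn_leq rkU1 /= ltn_neqAle eq_sym ne.
by rewrite rkS ?subsetUr.
Qed.

Lemma rk_leD D A B : A \subset B -> (rk D B <= rk D A + #|B :\: A|)%N.
Proof. by apply: subadd_card => e S; apply: rkU1. Qed.

Lemma rk_card D A : (rk D A <= #|A|)%N.
Proof. by have := rk_leD D (sub0set A); rewrite rk0 setD0. Qed.

Lemma rk_indepS D A B : A \subset B -> rk D B = #|B| -> rk D A = #|A|.
Proof.
move=> sAB rB; apply/eqP; rewrite eqn_leq rk_card /=.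
by have := rk_leD D sAB; have := cardsID A B; rewrite rB (setIidPr sAB); lia.
Qed.

Lemma rk_closed D A B :
  A \subset B -> (forall e, e \in B -> (rvec D e <= rspan D A)%MS) ->
  rk D B = rk D A.
Proof.
move=> sAB sB; apply/eqP; rewrite eqn_leq (rkS _ sAB) andbT.
by apply/mxrankS/rspan_subP.
Qed.

(** [I :\: A] is a basis of [P] in the contraction by [A], found by taking [I] maximal; [A] itself
    may be dependent. *)
Lemma rel_basis D A (P : {set E}) : A \subset P ->
  exists I : {set E}, [/\ A \subset I, I \subset P, rk D I = (rk D A + #|I :\: A|)%N
    & forall e, e \in P -> (rvec D e <= rspan D I)%MS].
Proof.
move=> sAP.
pose good := [pred I : {set E} |
  [&& A \subset I, I \subset P & rk D I == (rk D A + #|I :\: A|)%N]].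
have goodA : good A by rewrite /= subxx sAP setDv cards0 addn0 eqxx.
have [I /maxsetP[/and3P[sAI sIP /eqP rI] maxI] _] := maxset_exists goodA.
exists I; split=> // e eP; apply/negPn/negP => neI.
have eI : e \notin I by apply: contra neI => /rvec_sub.
have goodeI : good (e |: I).
  rewrite /= (subset_trans sAI) ?subsetUr // subUset sub1set eP sIP /=.
  have eA : e \notin A by apply: contra (subsetP sAI e) _.
  have -> : (e |: I) :\: A = e |: (I :\: A).
    by apply/setP => f; rewrite !inE; have [->|//] := eqVneq f e; rewrite eA.
  by rewrite rkU1_notin // rI cardsU1 inE (negPf eI) andbF addnCA add1n.
by move: eI; rewrite -{1}(maxI _ goodeI (subsetUr _ _)) setU11.
Qed.

Lemma rvec_restrict D D' : D \subset D' ->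
  exists M, forall e, rvec D e = rvec D' e *m M.
Proof.
move/subsetP=> sDD'; exists (diag_mx (\row_j (enum_val j \in D)%:R)) => e.
apply/rowP => j; rewrite mul_mx_diag !mxE.
have [/sDD' ->|_] := boolP (enum_val j \in D); first by rewrite mulr1.
by rewrite mulr0.
Qed.

(** Restricting the columns is a linear map, so dependencies among rows survive it. *)
Lemma rspan_cols D D' A e : D \subset D' ->
  (rvec D' e <= rspan D' A)%MS -> (rvec D e <= rspan D A)%MS.
Proof.
move=> /rvec_restrict[M rM] eA; rewrite rM (submx_trans (submxMr M eA)) //.
rewrite /rspan sumsmxMr; apply/sumsmx_subP => f fA.
by rewrite (eqmxMr M (genmxE _)) -rM rvec_sub.
Qed.

Lemma rk_cols D D' A : D \subset D' -> (rk D A <= rk D' A)%N.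
Proof.
move=> /rvec_restrict[M rM]; apply: leq_trans (mxrankM_maxl _ M).
apply/mxrankS/rspan_subP => e eA; rewrite rM; exact/submxMr/rvec_sub.
Qed.

(** A new column adds to each row a multiple of the unit vector [d], so the row space grows by at
    most a line. *)
Lemma rk_colsU1 D A t : (rk (t |: D) A <= (rk D A).+1)%N.
Proof.
pose d : 'rV[L]_#|E| := delta_mx 0 (enum_rank t).
apply: (@leq_trans (\rank (rspan D A + d)%MS)).
  apply/mxrankS/rspan_subP => e eA.
  have -> : rvec (t |: D) e = rvec D e + (C e t *+ (t \notin D)) *: d.
    apply/rowP => j; rewrite !mxE /= -(inj_eq enum_val_inj) enum_rankK !inE.
    have [->|_] := eqVneq (enum_val j) t; last by rewrite mulr0 addr0.
    by rewrite mulr1; case: (t \in D); rewrite ?addr0 ?add0r.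
  rewrite addmx_sub_adds ?rvec_sub //; exact: scalemx_sub.
rewrite -[leqRHS]addn1; apply: leq_trans (mxrank_adds_leqif _ _) _.
by rewrite leq_add2l rank_leq_row.
Qed.

Lemma rk_leDcols D D' A : D \subset D' -> (rk D' A <= rk D A + #|D' :\: D|)%N.
Proof.
by apply: (@subadd_card _ (fun S => rk S A)) => e S; apply: rk_colsU1.
Qed.

Definition row_mat D A : 'M[L]_(#|A|, #|E|) :=
  \matrix_(a, j) rvec D (enum_val a) 0 j.

Lemma rk_row_mat D A : rk D A = \rank (row_mat D A).
Proof.
apply/eqmx_rank/andP; split.
  apply/rspan_subP => e eA.
  have -> : rvec D e = row (enum_rank_in eA e) (row_mat D A).
    by apply/rowP => j; rewrite !mxE enum_rankK_in.
  exact: row_sub.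
apply/row_subP => a; have -> : row a (row_mat D A) = rvec D (enum_val a).
  by apply/rowP => j; rewrite !mxE.
exact/rvec_sub/enum_valP.
Qed.

Lemma rk_cols0 A : rk set0 A = 0%N.
Proof.
rewrite rk_row_mat; apply/eqP; rewrite mxrank_eq0; apply/eqP/matrixP => a j.
by rewrite !mxE inE.
Qed.

(** Each column outside [D] can account for at most one of the full rank, and so can each column in
    [D]. *)
Lemma rk_setT_full : rk setT setT = #|E| -> forall D, rk D setT = #|D|.
Proof.
move=> rE D; have := rk_leDcols setT (sub0set D).
have := rk_leDcols setT (subsetT D); rewrite rE rk_cols0 setD0 setTD.
have := cardsC D; lia.
Qed.

Definition cvec A t : 'cV[L]_#|A| := \col_a C (enum_val a) t.

(** Links the column spans that define the shifting to row ranks: a matrix and its transpose have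
    equal rank. *)
Lemma cvec_spanP A D t : t \notin D ->
  (cvec A t \in <<[seq cvec A u | u in D]>>%VS) = (rk (t |: D) A == rk D A).
Proof.
move=> tD.
pose M S := row_mat S A.
have colM (S : {set E}) u : u \in S -> col (enum_rank u) (M S) = cvec A u.
  by move=> uS; apply/colP => a; rewrite !mxE enum_rankK uS.
have colM0 (S : {set E}) u : u \notin S -> col (enum_rank u) (M S) = 0.
  by move=> uS; apply/colP => a; rewrite !mxE enum_rankK (negPf uS).
have colsub (S : {set E}) u m (N : 'M_(m, _)) : ((M S)^T <= N)%MS -> u \in S ->
    ((cvec A u)^T <= N)%MS.
  move=> sN uS; rewrite -(colM S u uS) tr_col; apply: submx_trans sN.
  exact: row_sub.
have subcol (S : {set E}) m (N : 'M_(m, _)) :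
    (forall u, u \in S -> ((cvec A u)^T <= N)%MS) -> ((M S)^T <= N)%MS.
  move=> sN; apply/row_subP => j; rewrite -tr_col -(enum_valK j).
  have [uS|uS] := boolP (enum_val j \in S); first by rewrite colM // sN.
  by rewrite colM0 // trmx0 sub0mx.
have sM : ((M D)^T <= (M (t |: D))^T)%MS.
  by apply: subcol => u uD; apply: (colsub (t |: D)); rewrite ?inE ?uD ?orbT.
rewrite !rk_row_mat -/(M _) -/(M _) -(mxrank_tr (M (_ |: _))) -(mxrank_tr (M D)) eq_sym.
rewrite (mxrank_leqif_sup sM).
have -> : ((M (t |: D))^T <= (M D)^T)%MS = ((cvec A t)^T <= (M D)^T)%MS.
  apply/idP/idP => [sN|tN]; first by apply: (colsub (t |: D)); rewrite ?setU11.
  apply: subcol => u; rewrite in_setU1 => /predU1P[->//|uD].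
  exact: (colsub D).
apply/idP/idP => [tX|/submxP[w tw]].
  rewrite (coord_span (X := in_tuple _) tX) linear_sum summx_sub //= => i _.
  rewrite linearZ scalemx_sub //.
  have /imageP[u uD ->] : (in_tuple [seq cvec A u | u in D])`_i
      \in [seq cvec A u | u in D] by rewrite mem_nth.
  exact: (colsub D).
have -> : cvec A t = \sum_j w 0 j *: (col j (M D)).
  rewrite -[LHS]trmxK tw trmx_mul trmxK; apply/colP => a; rewrite !mxE summxE.
  by apply: eq_bigr => j _; rewrite !mxE mulrC.
apply: memv_suml => j _; apply: memvZ; rewrite -(enum_valK j).
have [uS|uS] := boolP (enum_val j \in D); last by rewrite colM0 // mem0v.
by rewrite colM //; apply/memv_span/imageP; exists (enum_val j).
Qed.

End RowRank.

(** * The exchange argument for an abstract linear order on the columns *)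

Section MatroidalFiber.

Variables (L : fieldType) (E : finType) (C : E -> E -> L) (pos : E -> nat).
Implicit Types (A B D : {set E}) (e t u : E).

Definition below (j : nat) : {set E} := [set t | pos t < j].

Lemma belowS i j : i <= j -> below i \subset below j.
Proof. by move=> leij; apply/subsetP => t; rewrite !inE => /leq_trans; apply. Qed.

Lemma below_setT : below (\max_t pos t).+1 = setT.
Proof. by apply/setP => t; rewrite !inE ltnS leq_bigmax. Qed.

Hypothesis pos_inj : injective pos.
Hypothesis rk_setT : forall D, rk C D setT = #|D|.

Lemma rk_allcols A : rk C setT A = #|A|.
Proof. by apply: (rk_indepS (subsetT A)); rewrite rk_setT. Qed.

Lemma fiber_card (H A : {set E}) :
  (forall j, rk C (below j) A = #|H :&: below j|) -> #|A| = #|H|.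
Proof. by move/(_ (\max_t pos t).+1); rewrite below_setT rk_allcols setIT. Qed.

Lemma card_gap (H : {set E}) i j : i <= j ->
    (forall t, i <= pos t < j -> t \in H) ->
  #|H :&: below j| = #|H :&: below i| + #|below j :\: below i|.
Proof.
move=> leij sH; rewrite -(cardsID (below i) (H :&: below j)).
rewrite -setIA (setIidPr (belowS leij)); congr (_ + #|pred_of_set _|).
apply/setP => t; rewrite !inE -leqNgt; case: (leqP i _) => //= le_i.
by case: ltnP => lt_j; rewrite ?andbF ?andbT // sH // le_i.
Qed.

Variables (H : {set E}) (BB : {set {set E}}).
Hypothesis BBP :
  forall A, A \in BB <-> forall j, rk C (below j) A = #|H :&: below j|.

Lemma fiber_initial_matroid h : H = below h -> matroid_bases BB.
Proof.
move=> defH.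
(* The condition at [h] implies all others: shorter segments lose at most one rank per dropped
   column, longer ones are capped by [#|A|]. *)
have BE A : A \in BB <-> rk C (below h) A = #|A| /\ #|A| = #|H|.
  split=> [/BBP fA|[rA cA]].
    by have := fiber_card fA; split=> //; rewrite fA -defH setIid.
  apply/BBP => j; have [le_jh|/ltnW le_hj] := leqP j h.
    rewrite defH (setIidPr (belowS le_jh)); apply/eqP.
    rewrite eqn_leq -{1}(rk_setT (below j)) rkS ?subsetT //=.
    have := rk_leDcols C A (belowS le_jh); rewrite rA cA defH.
    have := cardsID (below j) (below h); rewrite (setIidPr (belowS le_jh)); lia.
  rewrite defH (setIidPl (belowS le_hj)) -defH -cA; apply/eqP.
  by rewrite eqn_leq rk_card -{1}rA rk_cols ?belowS.
split.
  have [I [_ _ rI sI]] := rel_basis C (below h) (sub0set [set: E]).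
  rewrite rk0 setD0 add0n in rI.
  apply/set0Pn; exists I; apply/BE; split=> //.
  by rewrite -rI -(rk_closed (subsetT I) sI) rk_setT defH.
move=> B1 B2 /BE[r1 c1] /BE[r2 c2] x; rewrite inE => /andP[xB2 xB1].
have cB1x : #|B1| = #|B1 :\ x|.+1 by rewrite (cardsD1 x) xB1.
(* If [B1 :\ x] spanned all of [B2], its rank would be at least [#|B2|], one more than its size. *)
have [sB|nsB] := boolP [forall y in B2, (rvec C (below h) y <= rspan C (below h) (B1 :\ x))%MS].
  have : rk C (below h) B2 <= rk C (below h) (B1 :\ x).
    by apply/mxrankS/rspan_subP => y yB2; apply: (forall_inP sB).
  have := rk_card C (below h) (B1 :\ x); rewrite r2; lia.
move: nsB; rewrite negb_forall_in => /exists_inP[y yB2 ny].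
have yB1x : y \notin B1 :\ x by apply: contra ny => /rvec_sub.
have nyx : y != x by apply: contraNneq xB2 => <-.
have yB1 : y \notin B1 by move: yB1x; rewrite !inE nyx.
exists y; rewrite ?inE ?yB1 //.
have cy : #|y |: (B1 :\ x)| = #|B1| by rewrite cardsU1 yB1x cB1x.
apply/BE; rewrite cy; split=> //; rewrite rkU1_notin // cB1x; congr _.+1.
exact: rk_indepS (subD1set _ _) r1.
Qed.

(** Transitive symmetry of the rows; for [k]-subsets, [p] comes from a permutation of the
    vertices. *)
Hypothesis sym : forall e e', exists2 p : E -> E, p e = e' &
  forall D A, rk C D (p @: A) = rk C D A.

Lemma fiber_matroid_initial t u :
  matroid_bases BB -> u \in H -> pos t < pos u -> t \in H.
Proof.
move=> [/set0Pn[G /[dup] GB /BBP rG] exch] uH lt_tu; apply/negPn/negP => tH.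
(* With [t] a gap below [u], [m] is the last element of [H] and [s] will be the last gap before
   [m]. *)
pose m := [arg max_(v > u in H) pos v].
have [mH maxm] : m \in H /\ (forall v, v \in H -> pos v <= pos m).
  by rewrite /m; case: arg_maxnP => // v vH maxv; split.
have gapt : (t \notin H) && (pos t < pos m).
  by rewrite tH (leq_trans lt_tu) ?maxm.
pose s := [arg max_(v > t | (v \notin H) && (pos v < pos m)) pos v].
have [sH lt_sm maxs] : [/\ s \notin H, pos s < pos m &
    forall v, v \notin H -> pos v < pos m -> pos v <= pos s].
  rewrite /s; case: arg_maxnP => // v /andP[vH ltv] maxv; split=> // w wH ltw.
  by apply: maxv; rewrite wH.
(* [below a] includes [s] as its last column and [below b] includes [m]; the columns after [s] up to
   [m] are all in [H]. *)
pose a := (pos s).+1; pose b := (pos m).+1.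
have le_ab : a <= b by rewrite ltnS ltnW.
have gapH v : a <= pos v < b -> v \in H.
  move=> /andP[lea]; rewrite ltnS leq_eqVlt => /predU1P[/pos_inj->//|ltv].
  by apply: contraLR lea => /maxs/(_ ltv); rewrite -leqNgt.
have hgap i j : a <= i -> i <= j -> j <= b ->
    #|H :&: below j| = #|H :&: below i| + #|below j :\: below i|.
  move=> leai leij lejb; apply: card_gap => // v /andP[lei ltj]; apply: gapH.
  by rewrite (leq_trans leai) ?(leq_trans ltj).
have htop j : b <= j -> H :&: below j = H.
  move=> lebj; apply/setIidPl/subsetP => v /maxm lev.
  by rewrite inE (leq_trans _ lebj).
have ha_H : #|H :&: below a| < #|H|.
  apply: proper_card; rewrite properE subsetIl; apply/subsetPn; exists m => //.
  by rewrite !inE mH ltnS -ltnNge.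
have ha_D : #|H :&: below a| < #|below a|.
  apply: proper_card; rewrite properE subsetIr; apply/subsetPn; exists s.
    by rewrite inE ltnSn.
  by rewrite inE (negPf sH).
have cG := fiber_card rG.
have rGb : rk C (below b) G = #|G| by rewrite rG htop ?cG.
(* All rows together have rank [#|below a|] there, more than [G] has, so [G] does not span. *)
have [e ne] : exists e, ~~ (rvec C (below a) e <= rspan C (below a) G)%MS.
  apply/existsP; rewrite -negb_forall; apply/negP => /forallP sG.
  have := rk_closed (subsetT G) (fun e _ => sG e); rewrite rk_setT rG; lia.
(* On [below a] the rank of [G] is less than [#|G|], so a basis of [G] omits some element, which is
   redundant. *)
have [x0 x0G rGx0] : exists2 x0, x0 \in G & rk C (below a) (G :\ x0) = rk C (below a) G.
  have [I [_ sIG rI sI]] := rel_basis C (below a) (sub0set G).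
  rewrite rk0 setD0 add0n in rI.
  have rIG := rk_closed sIG sI.
  have /properP[_ [x xG xI]] : I \proper G.
    by rewrite properEcard sIG -rI -rIG rG cG.
  have sIx : I \subset G :\ x by rewrite subsetD1 sIG.
  exists x => //; apply/eqP; rewrite eqn_leq rkS ?subD1set //= rIG.
  by rewrite rkS.
(* As [p] moves the unspanned [e] to [x0], the closure [P] of [p @: G] misses [x0]. *)
have [p pe rp] := sym e x0.
pose P := [set y | (rvec C (below a) y <= rspan C (below a) (p @: G))%MS].
have spGP : p @: G \subset P by apply/subsetP => y yG; rewrite inE rvec_sub.
have PE y : (y \in P) = (rvec C (below a) y <= rspan C (below a) (p @: G))%MS.
  by rewrite inE.
have x0P : x0 \notin P.
  rewrite PE -pe; apply/rk_spanP; rewrite -imsetU1 !rp.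
  by apply/rk_spanP.
have rP j : j <= a -> rk C (below j) P = #|H :&: below j|.
  move=> leja; rewrite -rG -(rp _ G); apply: rk_closed => // y; rewrite PE.
  exact/rspan_cols/belowS.
(* P lies in the closure of pG for all shorter column segments too, so the
   ranks of B are forced there; above a they can only grow one by one. *)
have [B [sB0B sBP rB sB]] := rel_basis C (below b) (subsetIr G P).
have rBb : rk C (below b) B = #|B|.
  have := cardsID (G :&: P) B; rewrite (setIidPr sB0B) rB.
  by rewrite (rk_indepS (subsetIl G P) rGb).
have rBj j : j <= b -> rk C (below j) B = rk C (below j) P.
  move=> lejb; apply/esym/rk_closed => // y /sB; exact/rspan_cols/belowS.
(* Upper bound: the columns between [a] and [b] all count in [H]. Lower bound: [P] contains
   [p @: G], of rank [#|G|] on [below b]. *)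
have cB : #|B| = #|H|.
  apply/eqP; rewrite eqn_leq -rBb rBj //; apply/andP; split.
    apply: leq_trans (rk_leDcols _ _ (belowS le_ab)) _.
    by rewrite rP // -hgap // htop.
  by rewrite -cG -rGb -(rp _ G) rkS.
have BB_B : B \in BB.
  apply/BBP => j; have [leja|/ltnW leaj] := leqP j a.
    by rewrite rBj ?rP // (leq_trans leja).
  have [lejb|/ltnW lebj] := leqP j b; last first.
    rewrite htop // -cB; apply/eqP.
    by rewrite eqn_leq rk_card -{1}rBb rk_cols ?belowS.
  (* From [a] to [b] the rank of [B] gains as much as there are columns, hence exactly one at
     each. *)
  have rBa : rk C (below a) B = #|H :&: below a| by rewrite rBj ?rP.
  have := rk_leDcols C B (belowS lejb); have := rk_leDcols C B (belowS leaj).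
  have : #|H :&: below b| = #|H| by rewrite htop.
  have := hgap j b leaj lejb (leqnn b); have := hgap a j (leqnn a) leaj lejb.
  by rewrite rBb cB rBa /=; lia.
have [I [sB0I sIB rI sI]] := rel_basis C (below a) sB0B.
(* If [I = B], every element of [B] beyond [G :&: P] raises the rank. But [B] has the size and rank
   of [G], in which [x0], outside [P], is redundant. *)
have /properP[_ [x xB xI]] : I \proper B.
  rewrite properEneq sIB andbT; apply/eqP => defI.
  have sB0 : G :&: P \subset G :\ x0.
    by rewrite subsetD1 subsetIl inE negb_and x0P orbT.
  have := rk_leD C (below a) sB0; rewrite rGx0 rG => rGa.
  move: rI; rewrite defI rBj // rP // => rI.
  have := cardsID (G :&: P) B; have := cardsID (G :&: P) (G :\ x0).
  have := cardsD1 x0 G; rewrite x0G (setIidPr sB0) (setIidPr sB0B).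
  by rewrite cB -cG; move: rI rGa; clear; lia.
have xG : x \notin G.
  apply: contra xI => xG; apply: (subsetP sB0I).
  by rewrite inE xG (subsetP sBP).
have sIBx : I \subset B :\ x by rewrite subsetD1 sIB.
have rBx : rk C (below a) (B :\ x) = rk C (below a) B.
  apply/eqP; rewrite eqn_leq rkS ?subD1set //= (rk_closed sIB sI).
  by rewrite rkS.
have [|y yGB /BBP yB] := exch B G BB_B GB x; first by rewrite inE xG.
move: yGB; rewrite inE => /andP[/negP yNB yG].
(* The exchanged set is in the fiber too, so its rank on [below a] is that of [B]; hence [y] is
   spanned by [B :\ x], inside the closed set [P]. *)
have /rk_spanP sy : rk C (below a) (y |: (B :\ x)) = rk C (below a) (B :\ x).
  by rewrite yB rBx rBj ?rP.
have yP : y \in P.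
  rewrite PE; apply: submx_trans sy _; apply/rspan_subP => z.
  by rewrite 2!inE => /andP[_ /(subsetP sBP)]; rewrite PE.
by apply: yNB; apply: (subsetP sB0B); rewrite inE yG.
Qed.

End MatroidalFiber.

(** * The lexicographic order as a numbering *)

Section LexOrder.

Variables n k : nat.
Implicit Types S T U : {set 'I_n}.

Lemma ltlexP S T :
  reflect (exists i : 'I_n,
             [/\ i \in S, i \notin T & forall j : 'I_n, j < i -> (j \in S) = (j \in T)])
          (ltlex S T).
Proof.
apply: (iffP exists_inP) => [[i iST /andP[/forall_inP mini iS]]|[i [iS iT eqST]]].
  exists i; split=> // [|j ltji]; first by move: iST; rewrite !inE iS /= andbT orbF.
  apply/eqP; apply: contraLR ltji => neST; rewrite -leqNgt; apply: mini.
  by rewrite !inE; move: neST; case: (j \in S); case: (j \in T).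
exists i; first by rewrite !inE iS iT.
rewrite iS andbT; apply/forall_inP => j; rewrite leqNgt !inE => jST.
by apply/negP => /eqST eqj; move: jST; rewrite eqj andNb.
Qed.

Lemma ltlex_irr S : ltlex S S = false.
Proof. by apply/ltlexP => -[i [->]]. Qed.

Lemma ltlex_trans : transitive (@ltlex n).
Proof.
move=> T S U /ltlexP[i [iS iT eqST]] /ltlexP[j [jT jU eqTU]]; apply/ltlexP.
case: (ltngtP i j) => [ltij|ltji|/val_inj eij].
- exists i; split; rewrite // -?eqTU // => l ltli.
  by rewrite eqST // eqTU // (ltn_trans ltli).
- exists j; split; rewrite // ?eqST // => l ltlj.
  by rewrite eqST ?eqTU // (ltn_trans ltlj).
- by rewrite -eij (negPf iT) in jT.
Qed.

Lemma ltlex_total S T : S != T -> ltlex S T || ltlex T S.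
Proof.
move=> neST; have [j0 j0P] : exists j0, j0 \in symdiff S T.
  apply/set0Pn; apply: contraNneq neST => /setP dST; apply/eqP/setP => j.
  by have := dST j; rewrite !inE; case: (j \in S); case: (j \in T).
have [i iST mini] := @arg_minnP _ j0 (mem (symdiff S T)) (@nat_of_ord n) j0P.
have eqST (j : 'I_n) : j < i -> (j \in S) = (j \in T).
  move=> ltji; apply/eqP; apply: contraLR ltji => neq; rewrite -leqNgt.
  by apply: mini; rewrite !inE; move: neq; case: (j \in S); case: (j \in T).
move: iST; rewrite !inE => /orP[]/andP[iT iS]; apply/orP; [left|right].
  by apply/ltlexP; exists i.
by apply/ltlexP; exists i; split=> // j /eqST.
Qed.

(** A numbering of the [k]-subsets in lexicographic order, to be used as [pos]. *)
Definition lexpos (T : ksub n k) : nat :=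
  #|[set R : ksub n k | ltlex (val R) (val T)]|.

Lemma lexpos_homo (R T : ksub n k) : ltlex (val R) (val T) -> lexpos R < lexpos T.
Proof.
move=> ltRT; apply: proper_card; rewrite properE; apply/andP; split.
  by apply/subsetP => S; rewrite !inE => /ltlex_trans; apply.
by apply/subsetPn; exists R; rewrite inE ?ltlex_irr.
Qed.

Lemma lexpos_inj : injective lexpos.
Proof.
move=> R T eqRT; apply/val_inj/eqP; apply/negPn/negP => /ltlex_total.
by case/orP => /lexpos_homo; rewrite eqRT ltnn.
Qed.

Lemma ltlexE (R T : ksub n k) : ltlex (val R) (val T) = (lexpos R < lexpos T).
Proof.
apply/idP/idP => [/lexpos_homo//|ltRT].
have neRT : val R != val T by apply: contraTneq ltRT => /val_inj ->; rewrite ltnn.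
by have /orP[//|/lexpos_homo/ltnW] := ltlex_total neRT; rewrite leqNgt ltRT.
Qed.

Lemma lelexE (R T : ksub n k) : lelex (val R) (val T) = (lexpos R <= lexpos T).
Proof.
by rewrite /lelex ltlexE [in RHS]leq_eqVlt (inj_eq lexpos_inj).
Qed.

Lemma below_lexposE (T : ksub n k) :
  [set R : ksub n k | ltlex (val R) (val T)] = below lexpos (lexpos T).
Proof. by apply/setP => R; rewrite !inE ltlexE. Qed.

Lemma below_lexposS (T : ksub n k) :
  below lexpos (lexpos T).+1 = T |: below lexpos (lexpos T).
Proof. by apply/setP => R; rewrite !inE ltnS leq_eqVlt (inj_eq lexpos_inj). Qed.

End LexOrder.

(** * The fiber described by ranks of initial segments of columns *)

Section Fiber.

Variables (L : fieldType) (n k : nat) (X : 'M[L]_n).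
Implicit Types (G H : {set ksub n k}) (T : ksub n k).

Let C := @minor L n k X.
Let D := below (@lexpos n k).

Lemma exterior_shiftE G T :
  (T \in exterior_shift X G) = (rk C (D (lexpos T).+1) G != rk C (D (lexpos T)) G).
Proof.
rewrite inE below_lexposE /D below_lexposS -cvec_spanP ?inE ?ltnn //.
Qed.

(** Along the segments both sides start at 0 and grow by 0 or 1, so they agree everywhere iff they
    jump at the same columns. The rank jumps at the elements of the shift, the count at those of
    [H]. *)
Lemma shift_fiberP G H :
  G \in shift_fiber X H <-> forall j, rk C (D j) G = #|H :&: D j|.
Proof.
have jumpH T : (T \in H) = (#|H :&: D (lexpos T).+1| != #|H :&: D (lexpos T)|).
  rewrite /D below_lexposS setIUr; have [TH|TH] := boolP (T \in H).
    have -> : H :&: [set T] = [set T] by apply/setIidPr; rewrite sub1set.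
    by rewrite cardsU1 !inE ltnn andbF add1n eqn_leq ltnn.
  have -> : H :&: [set T] = set0.
    by apply/setP => R; rewrite !inE; have [->|] := eqVneq R T; rewrite ?(negPf TH) ?andbF.
  by rewrite set0U eqxx.
rewrite inE; split=> [/eqP defH|rG]; last first.
  by apply/eqP/setP => T; rewrite exterior_shiftE !rG -jumpH.
elim=> [|j IHj].
  have -> : D 0 = set0 by apply/setP => R; rewrite !inE.
  by rewrite rk_cols0 setI0 cards0.
have [T /eqP posT|noT] := pickP [pred T : ksub n k | lexpos T == j]; last first.
  suff -> : D j.+1 = D j by [].
  by apply/setP => T; rewrite !inE ltnS leq_eqVlt; have /= -> := noT T.
have := jumpH T; rewrite -{1}defH exterior_shiftE posT IHj.
have -> : D j.+1 = T |: D j by rewrite /D -posT below_lexposS.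
have leC : rk C (D j) G <= rk C (T |: D j) G <= (rk C (D j) G).+1.
  by rewrite rk_colsU1 rk_cols // subsetUr.
have leH : #|H :&: D j| <= #|H :&: (T |: D j)| <= #|H :&: D j|.+1.
  rewrite setIUr subset_leq_card ?subsetUr //=.
  apply: leq_trans (leq_card_setU _ _) _; rewrite addnC -[leqRHS]addn1 leq_add2l.
  by rewrite -(cards1 T) subset_leq_card ?subsetIr.
by move: leC leH; rewrite IHj; lia.
Qed.

End Fiber.

(** * Generic matrices: maximal ranks and invariance under vertex permutations *)

Section Generic.

Local Open Scope ring_scope.

Variables (F L : fieldType) (iota : {rmorphism F -> L}).

Lemma rank_unit_minor p q (A : 'M[L]_(p, q)) :
  exists f : 'I_(\rank A) -> 'I_p, exists g : 'I_(\rank A) -> 'I_q,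
    \det (mxsub f g A) != 0.
Proof.
have := maxrowsub_free A; set f := maxrankfun A => freeA.
have fullAt : row_full (rowsub f A)^T by rewrite /row_full mxrank_tr.
exists f, (fullrankfun fullAt).
rewrite -unitfE -unitmxE -row_full_unit /row_full -mxrank_tr.
have -> : (mxsub f (fullrankfun fullAt) A)^T =
    rowsub (fullrankfun fullAt) (rowsub f A)^T by apply/matrixP => i j; rewrite !mxE.
by rewrite mxrank_fullrowsub.
Qed.

Lemma rank_ge_minor p q r (A : 'M[L]_(p, q)) (f : 'I_r -> 'I_p) (g : 'I_r -> 'I_q) :
  \det (mxsub f g A) != 0 -> (r <= \rank A)%N.
Proof.
rewrite -unitfE -unitmxE => /mxrank_unit <-.
have -> : mxsub f g A = rowsub f 1%:M *m A *m colsub g 1%:M.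
  by rewrite mulmx_colsub mulmx1 -rowsubE -mxsub_comp.
by apply: leq_trans (mxrankM_maxl _ _) _; apply: mxrankM_maxr.
Qed.

(** A minor nonzero at [x] is a nonzero polynomial, hence nonzero at the independent point [y]. *)
Lemma generic_rank_le m (x y : 'I_m -> L) p q (M : 'M[{mpoly F[m]}]_(p, q)) :
    alg_independent iota y ->
  (\rank (map_mx (mmap iota x) M) <= \rank (map_mx (mmap iota y) M))%N.
Proof.
move=> indy; have [f [g]] := rank_unit_minor (map_mx (mmap iota x) M).
rewrite -map_mxsub det_map_mx => det_x.
apply: (@rank_ge_minor _ _ _ _ f g); rewrite -map_mxsub det_map_mx.
by apply: contraNneq det_x => /indy ->; rewrite rmorph0.
Qed.

Lemma mmap_msym m (s : 'S_m) (x : 'I_m -> L) (p : {mpoly F[m]}) :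
  mmap iota x (msym s p) = mmap iota (x \o s) p.
Proof.
elim/mpolyind: p => [|c u p _ _ IHp]; first by rewrite !raddf0.
rewrite !raddfD /= IHp msymZ !mmapZ; congr (_ * _ + _).
rewrite /msym !mmapX rmorph_prod; apply: eq_bigr => i _.
by rewrite rmorphXn /= mmapX mmap1U.
Qed.

Section Matrix.

Variable n : nat.
Implicit Type X : 'M[L]_n.

(** A relation between the permuted entries becomes one between the original entries after permuting
    the variables, which is invertible on polynomials. *)
Lemma generic_row_perm (s : 'S_n) X :
  generic_matrix iota X -> generic_matrix iota (row_perm s X).
Proof.
have [g gK' Kg'] := curry_mxvec_bij n n.
have gK : cancel (uncurry (@mxvec_index n n)) g by move=> u; apply: gK'.
have Kg : cancel g (uncurry (@mxvec_index n n)) by move=> r; apply: Kg'.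
(* The map on flattened indices that sends the entry [(i, j)] to [(s i, j)]. *)
have shift_inj : injective (fun r => mxvec_index (s (g r).1) (g r).2).
  move=> r r'; set f := fun u : 'I_n * 'I_n => mxvec_index (s u.1) u.2.
  suff f_inj : injective f by move/f_inj/(can_inj Kg).
  move=> [i j] [i' j'] /(can_inj gK (x1 := (s i, j)) (x2 := (s i', j'))).
  by case=> /perm_inj -> ->.
move=> genX p; pose t := perm shift_inj.
have eqx : mxvec (row_perm s X) ord0 =1 mxvec X ord0 \o t.
  move=> r; rewrite /= permE -{1}(Kg r); case: (g r) => i j /=.
  by rewrite !mxvecE mxE.
have -> : mmap iota (fun r => mxvec (row_perm s X) ord0 r) p
    = mmap iota (fun r => mxvec X ord0 r) (msym t p).
  rewrite mmap_msym /mmap; apply: eq_bigr => u _; congr (_ * _).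
  by apply: eq_bigr => i _; rewrite eqx.
by move/genX => /(congr1 (msym t^-1)%g); rewrite msym0 -msymMm mulgV msym1m.
Qed.

Variable k : nat.

Definition poly_minor (S T : ksub n k) : {mpoly F[n * n]} :=
  \det (mxsub (ksub_nth S) (ksub_nth T) (\matrix_(i, j) 'X_(mxvec_index i j))).

Lemma eval_poly_minor X S T :
  mmap iota (mxvec X ord0) (poly_minor S T) = minor X S T.
Proof.
rewrite -det_map_mx map_mxsub; congr (\det (mxsub _ _ _)).
apply/matrixP => i j; by rewrite 2!mxE /= mmapX mmap1U mxvecE.
Qed.

Lemma rk_generic_le X Y (D A : {set ksub n k}) :
  generic_matrix iota Y -> (rk (minor X) D A <= rk (minor Y) D A)%N.
Proof.
move=> genY; pose M : 'M[{mpoly F[n * n]}]_(#|A|, #|{: ksub n k}|) :=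
  \matrix_(a, j) (poly_minor (enum_val a) (enum_val j) *+ (enum_val j \in D)).
have evM Z : row_mat (minor Z) D A = map_mx (mmap iota (mxvec Z ord0)) M.
  by apply/matrixP => a j; rewrite !mxE raddfMn /= eval_poly_minor.
by rewrite !rk_row_mat !evM; apply: generic_rank_le.
Qed.

Lemma rk_generic X Y (D A : {set ksub n k}) :
    generic_matrix iota X -> generic_matrix iota Y ->
  rk (minor X) D A = rk (minor Y) D A.
Proof. by move=> gX gY; apply/eqP; rewrite eqn_leq !rk_generic_le. Qed.

Lemma ksub_nth_inj (S : ksub n k) : injective (ksub_nth S).
Proof. by move=> a b /enum_val_inj/cast_ord_inj. Qed.

Lemma ksub_nth_in (S : ksub n k) a : ksub_nth S a \in val S.
Proof. exact: enum_valP. Qed.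

Lemma ksub_nth_onto (S : ksub n k) i : i \in val S -> exists a, i = ksub_nth S a.
Proof.
move=> iS; exists (cast_ord (eqP (valP S)) (enum_rank_in iS i)).
by rewrite /ksub_nth cast_ordK enum_rankK_in.
Qed.

Lemma minor1 (S T : ksub n k) : minor (1%:M : 'M[L]_n) S T = (S == T)%:R.
Proof.
have [->|neST] := eqVneq S T.
  rewrite /minor (_ : mxsub _ _ _ = 1%:M) ?det1 //; apply/matrixP => a b.
  by rewrite !mxE (inj_eq (@ksub_nth_inj T)).
have [i iS iT] : exists2 i, i \in val S & i \notin val T.
  apply/subsetPn; apply: contra neST => sST; apply/eqP/val_inj/eqP.
  by rewrite eqEcard sST (eqP (valP S)) (eqP (valP T)) leqnn.
have [a def_i] := ksub_nth_onto iS.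
rewrite /minor (expand_det_row _ a) big1 // => b _; rewrite !mxE -def_i.
case: eqP => [eq_i|_]; last by rewrite mul0r.
by rewrite eq_i ksub_nth_in in iT.
Qed.

(** The generic rank is at least the rank at the identity matrix, whose compound matrix is again an
    identity. *)
Lemma rk_generic_setT X (D : {set ksub n k}) :
  generic_matrix iota X -> rk (minor X) D setT = #|D|.
Proof.
move=> genX; apply: rk_setT_full; apply/eqP; rewrite eqn_leq.
rewrite -{1}cardsT rk_card /=.
apply: leq_trans (rk_generic_le (1%:M) setT setT genX).
rewrite /rk; apply: leq_trans (mxrankS (_ : (1%:M <= _)%MS)); first by rewrite mxrank1.
apply/row_subP => i; have -> : row i 1%:M = rvec (minor (1%:M : 'M[L]_n)) setT (enum_val i).
  by apply/rowP => j; rewrite !mxE inE minor1 (inj_eq enum_val_inj).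
by rewrite rvec_sub ?inE.
Qed.

Lemma ksub_image_proof (s : 'S_n) (S : ksub n k) : #|s @: val S| == k.
Proof. by rewrite card_imset ?(eqP (valP S)) //; apply: perm_inj. Qed.

Definition ksub_image (s : 'S_n) (S : ksub n k) : ksub n k :=
  Sub (s @: val S) (ksub_image_proof s S).

(** [s] need not preserve the order of [S], so sorting the image permutes the rows. The sign does
    not depend on [T], which makes whole compound rows proportional. *)
Lemma minor_row_perm (s : 'S_n) X (S : ksub n k) :
  exists b : bool, forall T, minor (row_perm s X) S T = (-1) ^+ b * minor X (ksub_image s S) T.
Proof.
have /fin_all_exists[h hE] : forall a : 'I_k, exists b,
    s (ksub_nth S a) = ksub_nth (ksub_image s S) b.
  by move=> a; apply: ksub_nth_onto; rewrite imset_f ?ksub_nth_in.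
have h_inj : injective h.
  move=> a b eq_h; apply: (@ksub_nth_inj S); apply: (@perm_inj _ s).
  by rewrite !hE eq_h.
(* The permutation is coerced to its parity. *)
exists (perm h_inj) => T; rewrite -det_perm -det_mulmx -row_permE.
by congr (\det _); apply/matrixP => a b; rewrite !mxE permE hE.
Qed.

(** Up to sign, the compound row of [ksub_image s S] for [X] is that of [S] for the row-permuted
    matrix, and any two generic matrices give equal ranks. *)
Lemma rk_ksub_image (s : 'S_n) X (D A : {set ksub n k}) :
  generic_matrix iota X -> rk (minor X) D (ksub_image s @: A) = rk (minor X) D A.
Proof.
move=> genX; rewrite -(rk_generic _ A (generic_row_perm (s := s) genX) genX).
have rvecE S : (rvec (minor X) D (ksub_image s S) :=: rvec (minor (row_perm s X)) D S)%MS.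
  have [b minE] := minor_row_perm s X S.
  have -> : rvec (minor (row_perm s X)) D S = (-1) ^+ b *: rvec (minor X) D (ksub_image s S).
    by apply/rowP => j; rewrite !mxE minE mulrnAr.
  by apply/eqmx_sym/eqmx_scale; rewrite signr_eq0.
apply/eqmx_rank/andP; split; apply/rspan_subP.
  by move=> _ /imsetP[S SA ->]; rewrite rvecE rvec_sub.
by move=> S SA; rewrite -rvecE rvec_sub ?imset_f.
Qed.

(** [S] followed by its complement is matched, position by position, with [T] followed by its
    complement. *)
Lemma ksub_image_trans (S T : ksub n k) : exists s, ksub_image s S = T.
Proof.
pose e (R : ksub n k) := enum (val R) ++ enum (~: val R).
have mem_e R i : i \in e R by rewrite mem_cat !mem_enum !inE orbN.
have size_e R : size (e R) = n.
  by rewrite size_cat -!cardE cardsC card_ord.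
have uniq_e R : uniq (e R).
  rewrite cat_uniq !enum_uniq andbT /= -all_predC; apply/allP => i.
  by rewrite /= !mem_enum inE.
have lt_e i : (index i (e S) < size (e T))%N.
  by rewrite size_e -[ltnRHS](size_e S) index_mem.
pose f i := nth i (e T) (index i (e S)).
have f_inj : injective f.
  move=> i j; rewrite /f (set_nth_default j) // => /eqP.
  by rewrite nth_uniq // => /eqP; apply: index_inj.
exists (perm f_inj); apply/val_inj/eqP; rewrite eqEcard.
rewrite (eqP (valP (ksub_image _ _))) (eqP (valP T)) leqnn andbT.
apply/subsetP => _ /imsetP[i iS ->]; rewrite permE /f /e index_cat mem_enum iS.
have lt_i : (index i (enum (val S)) < size (enum (val T)))%N.
  have -> : size (enum (val T)) = size (enum (val S)).
    by rewrite -!cardE (eqP (valP T)) (eqP (valP S)).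
  by rewrite index_mem mem_enum.
by rewrite nth_cat lt_i -mem_enum mem_nth.
Qed.

End Matrix.

End Generic.

Theorem theorem1p3 (F L : fieldType) (iota : {rmorphism F -> L}) (n k : nat)
    (X : 'M[L]_n) (hX : generic_matrix iota X) (hk : 4 <= k)
    (H : {set ksub n k}) (hH0 : H != set0) (hH : shifted H)
    (hs : s_of H = None \/
          exists s : {set 'I_n}, s_of H = Some s /\ s \notin edges H) :
  matroidal X H <-> initial_lex_segment H.
Proof.
have rkT (D : {set ksub n k}) := rk_generic_setT D hX.
have fibP G := shift_fiberP X G H.
split=> [matH|[T defH]]; last first.
  (* [below] is strict, so the successor is what puts [T] itself in the segment. *)
  apply: (fiber_initial_matroid rkT fibP (h := (lexpos T).+1)).
  by rewrite {1}defH; apply/setP => R; rewrite !inE lelexE ltnS.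
(* [H] will be the segment ending at its last element [T], being closed downwards. *)
have [T0 T0H] := set0Pn _ hH0.
pose T := [arg max_(R > T0 in H) lexpos R].
have [TH maxT] : T \in H /\ forall R, R \in H -> lexpos R <= lexpos T.
  by rewrite /T; case: arg_maxnP => // R RH maxR; split.
exists T; apply/setP => R; rewrite inE lelexE; apply/idP/idP; first exact: maxT.
rewrite leq_eqVlt => /predU1P[/lexpos_inj->//|].
apply: (fiber_matroid_initial (@lexpos_inj n k) rkT fibP) => // S S'.
have [s sS] := ksub_image_trans S S'.
by exists (ksub_image s) => // D A; apply: rk_ksub_image hX.
Qed.
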